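(* Let $(X,\varphi)$ be a Cantor minimal system and let $(Z,\eta)$ be an odometer. Then there is at most one factor map (up to conjugacy) from $(X,\varphi)$ to $(Z,\eta)$; that is, if $\beta_1,\beta_2:(X,\varphi)\to(Z,\eta)$ are factor maps then there is a conjugacy $\gamma:(Z,\eta)\to(Z,\eta)$ such that $\beta_1=\gamma\circ\beta_2$.
   Context: A Cantor minimal system $(X,\varphi)$ is a minimal homeomorphism $\varphi$ of a space $X$ homeomorphic to the Cantor set. A factor map $(X,\varphi)\to(Y,\psi)$ is a continuous surjection $\alpha:X\to Y$ with $\alpha\circ\varphi=\psi\circ\alpha$; a conjugacy is a factor map that is a homeomorphism. For a sequence $(k_n)_{n\ge1}$ of positive integers, an odometer of type $(k_n)_{n\ge1}$ is the minimal system $(X,\varphi)$ with $X=\prod_{n=1}^\infty\{0,1,\ldots,k_n-1\}$ and $\varphi$ the addition of $(1,0,0,\ldots)$ with carrying (to the right). Trivial odometers, with $X$ finite (i.e. $k_n=1$ for all but finitely many $n$), are included. *)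

(* Defs.v *)
From HB Require Import structures.
From mathcomp Require Import all_boot.
From mathcomp Require Import all_classical topology cantor.

Set Implicit Arguments.
Unset Strict Implicit.
Unset Printing Implicit Defensive.

Local Open Scope classical_set_scope.

Definition homeomorphism (S T : topologicalType) (f : S -> T) : Prop :=
  continuous f /\
  exists g : T -> S, [/\ continuous g, cancel f g & cancel g f].

Definition minimal (X : topologicalType) (phi : X -> X) : Prop :=
  forall A : set X, closed A -> phi @` A = A -> A = set0 \/ A = [set: X].

Definition cantor_minimal_system (X : topologicalType) (phi : X -> X) : Prop :=
  [/\ exists f : X -> cantor_space, homeomorphism f,
      homeomorphism phi &
      minimal phi].

Definition factor_map (X Y : topologicalType) (phi : X -> X) (psi : Y -> Y)
    (alpha : X -> Y) : Prop :=
  [/\ continuous alpha,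
      set_surj [set: X] [set: Y] alpha &
      alpha \o phi = psi \o alpha].

Definition conjugacy (X Y : topologicalType) (phi : X -> X) (psi : Y -> Y)
    (alpha : X -> Y) : Prop :=
  factor_map phi psi alpha /\ homeomorphism alpha.

(* Sequences are indexed from 0: [k n] stands for the (n+1)-st integer of the
   type of the odometer, and [odometer_space k] is the product of the finite
   discrete spaces {0, ..., k n - 1}.  *)
Definition odometer_space (k : nat -> nat) : Type :=
  prod_topology (fun n => discrete_topology 'I_(k n)).

HB.instance Definition _ (k : nat -> nat) := Topological.on (odometer_space k).

(* The carry entering coordinate [n] when (1, 0, 0, ...) is added to [x]. The
   initial carry, [true], is the digit 1 that is added in coordinate 0.  *)
Fixpoint odometer_carry (k : nat -> nat) (x : odometer_space k) (n : nat)
    : bool :=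
  if n is m.+1 then odometer_carry x m && ((x m).+1 == k m) else true.

(* [ordS] is the successor modulo [k n]. *)
Definition odometer_map (k : nat -> nat) (x : odometer_space k)
    : odometer_space k :=
  fun n => if odometer_carry x n then ordS (x n) else x n.

(* Main.v *)
Require Import Defs.
From mathcomp Require Import all_boot all_classical topology.

Set Implicit Arguments.
Unset Strict Implicit.
Unset Printing Implicit Defensive.

Local Open Scope classical_set_scope.

(** Write [psi] for the odometer, and [z ~_n w] when [z] and [w] agree in their
    first [n] coordinates.  Since carries only travel to the right, [psi] acts
    on [~_n]-classes, and it acts injectively on them.

    The heart of the matter is that the class of [beta1 x] is determined by the
    class of [beta2 x]: if [beta2 x ~_n beta2 y], then [beta1 x ~_n beta1 y]
    (lemma [factor_maps_same_prefix]).  By minimality, an invariant closed set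
    of [X] containing [y] is everything.  Applied to the set of those [x] for
    which there are [a] and [m] with [psi^a (beta_i x) ~_n psi^m (beta_i y)] for
    both [i = 1] and [i = 2], this gives common exponents [a] and [m] for the
    given [x].  If [beta2 x ~_n beta2 y], then [psi^a] and [psi^m] agree at
    [beta2 y] modulo [~_n].  Now [psi] is transitive on classes (minimality
    again), and powers of a transitive injective map that agree at one point
    agree everywhere; so [psi^a] and [psi^m] agree at [beta1 y] as well,
    whence [psi^a (beta1 x) ~_n psi^a (beta1 y)], and [psi^a] cancels.
    Allowing iterates on both sides makes this set invariant under both [phi]
    and its inverse, so that the finiteness of the set of classes plays no
    role.

    Consequently [beta2 x |-> beta1 x] is a well-defined map [gamma] of the
    odometer that preserves every [~_n], hence is continuous; exchanging the
    roles of [beta1] and [beta2] yields its continuous inverse, and [gamma]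
    commutes with [psi] because both [beta1] and [beta2] do. *)

(** [z] and [w] agree in their first [n] coordinates. *)
Definition same_prefix (k : nat -> nat) (n : nat) (z w : odometer_space k) :=
  forall i : nat, (i < n)%N -> z i = w i.

Section Prefix.
Variable k : nat -> nat.
Implicit Types z w u : odometer_space k.
Local Notation psi := (@odometer_map k).

Lemma same_prefix_sym n z w : same_prefix n z w -> same_prefix n w z.
Proof. by move=> h i /h. Qed.

Lemma same_prefix_trans n w z u :
  same_prefix n z w -> same_prefix n w u -> same_prefix n z u.
Proof. by move=> h h' i lin; rewrite h ?h'. Qed.

Lemma same_prefix_carry n z w : same_prefix n z w ->
  odometer_carry z n = odometer_carry w n.
Proof.
elim: n => [//|n IH] zw /=.
by rewrite IH ?zw// => i lin; apply: zw; exact: ltnW.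
Qed.

Lemma same_prefix_map n z w :
  same_prefix n z w -> same_prefix n (psi z) (psi w).
Proof.
move=> zw i lin; rewrite /odometer_map zw//.
rewrite (@same_prefix_carry i z w)// => j lji.
by apply: zw; exact: ltn_trans lin.
Qed.

(** If the images agree, then the carries agree inductively from left to right,
    so that each digit can be recovered. *)
Lemma same_prefix_map_inj n z w :
  same_prefix n (psi z) (psi w) -> same_prefix n z w.
Proof.
elim: n => [//|n IH] h.
have zw : same_prefix n z w by apply: IH => i lin; apply: h; exact: ltnW.
move=> i; rewrite ltnS leq_eqVlt => /predU1P[->|]; last exact: zw.
have := h n (ltnSn n); rewrite /odometer_map (same_prefix_carry zw).
by case: ifP => // _ /ordS_inj.
Qed.

Lemma same_prefix_iter p n z w :
  same_prefix n (iter p psi z) (iter p psi w) <-> same_prefix n z w.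
Proof.
elim: p => [//|p IH]; rewrite !iterS -IH; split.
- exact: same_prefix_map_inj.
- exact: same_prefix_map.
Qed.

Lemma nbhs_same_prefix n z : nbhs z [set w | same_prefix n w z].
Proof.
elim: n => [|n IH]; first exact: filterE.
have Hn : nbhs z (@proj nat (fun n => discrete_topology 'I_(k n)) n
                    @^-1` [set z n]).
  by apply: (@proj_continuous nat (fun n => discrete_topology 'I_(k n)) n z);
    rewrite nbhs_principalE.
apply: filterS (filterI IH Hn) => w [wz wzn] i.
rewrite ltnS leq_eqVlt => /predU1P[->|]; last exact: wz.
exact: wzn.
Qed.

(** Such a map is non-expanding for the usual ultrametric on the product. *)
Lemma continuous_same_prefix (g : odometer_space k -> odometer_space k) :
  (forall n z w, same_prefix n z w -> same_prefix n (g z) (g w)) ->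
  continuous g.
Proof.
move=> gP z; apply/cvg_sup; first exact: fmap_filter (nbhs_filter z).
move=> i; move: z.
apply: (@continuous_comp_initial _ _ _ (proj i)) => z U /=.
rewrite nbhs_principalE => Uz.
apply: filterS (nbhs_same_prefix i.+1 z) => w /gP wz /=.
by rewrite /proj /= (wz i (ltnSn i)); exact: Uz.
Qed.

End Prefix.

(** In a minimal system, a closed set that contains [x] exactly when it contains
    [phi x] is empty or everything. *)
Lemma minimal_closed (X : topologicalType) (phi : X -> X) (P : set X) (y : X) :
  set_surj [set: X] [set: X] phi -> minimal phi -> closed P ->
  (forall x, P (phi x) <-> P x) -> P y -> forall x, P x.
Proof.
move=> phi_surj phi_min Pclosed Pinv Py x.
have phiP : phi @` P = P.
  apply/seteqP; split=> [_ [u Pu <-]|u Pu]; first exact/Pinv.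
  by move: Pu; have [v _ <-] := phi_surj u I => /Pinv Pv; exists v.
case: (phi_min _ Pclosed phiP) => P0; last by rewrite P0.
by move: Py; rewrite P0.
Qed.

Section TwoFactorMaps.
Variables (X : topologicalType) (phi : X -> X) (k : nat -> nat).
Local Notation psi := (@odometer_map k).
Hypotheses (phi_surj : set_surj [set: X] [set: X] phi) (phi_min : minimal phi).

(** A set that is a union of classes of the relation [b1 x ~_n b1 y] and
    [b2 x ~_n b2 y] is closed, because its complement is such a union too and
    the classes are open. *)
Lemma closed_same_prefix (b1 b2 : X -> odometer_space k) n (P : set X) :
  continuous b1 -> continuous b2 ->
  (forall x y, same_prefix n (b1 x) (b1 y) -> same_prefix n (b2 x) (b2 y) ->
     P y -> P x) ->
  closed P.
Proof.
move=> b1c b2c Psat; rewrite -openC openE => y nPy.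
have near1 : \forall x \near y, same_prefix n (b1 x) (b1 y).
  exact: b1c (nbhs_same_prefix n (b1 y)).
have near2 : \forall x \near y, same_prefix n (b2 x) (b2 y).
  exact: b2c (nbhs_same_prefix n (b2 y)).
apply: filterS2 near1 near2 => x h1 h2 Px; apply: nPy.
by apply: Psat Px; exact: same_prefix_sym.
Qed.

(** As a factor of a minimal system, the odometer acts transitively on the
    classes of [~_n]: the forward orbits of any two classes meet. *)
Lemma odometer_prefix_transitive (b : X -> odometer_space k) n z w :
  factor_map phi psi b ->
  exists p q, same_prefix n (iter p psi z) (iter q psi w).
Proof.
move=> [b_cont b_surj b_comm].
have bphi x : b (phi x) = psi (b x) by exact: (congr1 (@^~ x) b_comm).
have [x _ <-] := b_surj z I; have [y _ <-] := b_surj w I.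
pose P := [set x | exists p q,
  same_prefix n (iter p psi (b x)) (iter q psi (b y))].
suff : P x by [].
apply: (@minimal_closed _ phi _ y) => //.
- apply: (@closed_same_prefix b b n) => // u v uv _ [p [q pq]].
  exists p, q; apply: same_prefix_trans pq; exact/same_prefix_iter.
- move=> u; split=> [] [p [q pq]].
  + by exists p.+1, q; rewrite iterSr -bphi.
  + by exists p, q.+1; rewrite bphi -iterSr !iterS; exact: same_prefix_map.
- by exists 0, 0.
Qed.

(** The first [n] coordinates of [b2 x] determine those of [b1 x]. *)
Lemma factor_maps_same_prefix (b1 b2 : X -> odometer_space k) n x y :
  factor_map phi psi b1 -> factor_map phi psi b2 ->
  same_prefix n (b2 x) (b2 y) -> same_prefix n (b1 x) (b1 y).
Proof.
move=> fb1 fb2 b2xy.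
have [b1_cont b1_surj b1_comm] := fb1; have [b2_cont b2_surj b2_comm] := fb2.
have b1phi u : b1 (phi u) = psi (b1 u) by exact: (congr1 (@^~ u) b1_comm).
have b2phi u : b2 (phi u) = psi (b2 u) by exact: (congr1 (@^~ u) b2_comm).
pose P := [set u | exists a m,
  same_prefix n (iter a psi (b1 u)) (iter m psi (b1 y)) /\
  same_prefix n (iter a psi (b2 u)) (iter m psi (b2 y))].
have [a [m [h1 h2]]] : P x.
  apply: (@minimal_closed _ phi _ y) => //.
  - apply: (@closed_same_prefix b1 b2 n) => // u v uv1 uv2 [a [m [h1 h2]]].
    exists a, m; split; [apply: same_prefix_trans h1
                        |apply: same_prefix_trans h2]; exact/same_prefix_iter.
  - move=> u; split=> [] [a [m [h1 h2]]].
    + by exists a.+1, m; rewrite !iterSr -b1phi -b2phi.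
    + exists a, m.+1; rewrite b1phi b2phi -!iterSr !iterS.
      by split; exact: same_prefix_map.
  - by exists 0, 0.
(* It remains to compare [psi^m] and [psi^a] at [b1 y]: they agree at [b2 y]
   modulo [~_n], and [psi^p (b1 y)] is in the class of [psi^q (b2 y)]. *)
have [p [q pq]] := odometer_prefix_transitive n (b1 y) (b2 y) fb1.
apply/(same_prefix_iter a); apply: same_prefix_trans h1 _.
apply/(same_prefix_iter p).
have ham : same_prefix n (iter m psi (b2 y)) (iter a psi (b2 y)).
  apply: same_prefix_trans (same_prefix_sym h2) _; exact/same_prefix_iter.
have comm i j (z : odometer_space k) :
    iter i psi (iter j psi z) = iter j psi (iter i psi z).
  by rewrite -!iterD addnC.
rewrite comm [iter p _ (iter a _ _)]comm.
apply: same_prefix_trans (proj2 (same_prefix_iter m _ _ _) pq) _.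
apply: same_prefix_trans
  (proj2 (same_prefix_iter a _ _ _) (same_prefix_sym pq)).
rewrite comm [iter a _ (iter q _ _)]comm.
exact/same_prefix_iter.
Qed.

(** [b1] factors continuously through [b2]: compose [b1] with any section of
    [b2]. *)
Lemma factor_maps_lift (b1 b2 : X -> odometer_space k) :
  factor_map phi psi b1 -> factor_map phi psi b2 ->
  exists g : odometer_space k -> odometer_space k,
    continuous g /\ forall x, g (b2 x) = b1 x.
Proof.
move=> fb1 fb2; have [_ b2_surj _] := fb2.
have /choice[s sK] z : exists x, b2 x = z.
  by have [x _ <-] := b2_surj z I; exists x.
exists (b1 \o s); split.
  apply: continuous_same_prefix => n z w zw /=.
  by apply: factor_maps_same_prefix fb1 fb2 _; rewrite !sK.
move=> x /=; apply: functional_extensionality_dep => i.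
by apply: (@factor_maps_same_prefix _ _ i.+1 _ _ fb1 fb2); rewrite ?sK.
Qed.

End TwoFactorMaps.

Theorem proposition4p14 (X : topologicalType) (phi : X -> X)
    (hX : cantor_minimal_system phi)
    (k : nat -> nat) (hk : forall n : nat, (0 < k n)%N)
    (beta1 beta2 : X -> odometer_space k)
    (hbeta1 : factor_map phi (@odometer_map k) beta1)
    (hbeta2 : factor_map phi (@odometer_map k) beta2) :
  exists gamma : odometer_space k -> odometer_space k,
    conjugacy (@odometer_map k) (@odometer_map k) gamma /\
    beta1 = gamma \o beta2.
Proof.
have [_ [_ [f [_ _ fK]]] phi_min] := hX.
have phi_surj : set_surj [set: X] [set: X] phi by move=> x _; exists (f x).
have [g [g_cont gE]] := factor_maps_lift phi_surj phi_min hbeta1 hbeta2.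
have [h [h_cont hE]] := factor_maps_lift phi_surj phi_min hbeta2 hbeta1.
have [_ b1_surj b1_comm] := hbeta1; have [_ b2_surj b2_comm] := hbeta2.
exists g; split; last by apply: funext => x /=; rewrite gE.
have gK : cancel g h.
  by move=> z; have [x _ <-] := b2_surj z I; rewrite gE hE.
have hK : cancel h g.
  by move=> z; have [x _ <-] := b1_surj z I; rewrite hE gE.
split; last by split=> //; exists h.
split=> //; first by move=> z _; exists (h z).
apply: funext => z /=; have [x _ <-] := b2_surj z I.
have -> : odometer_map (beta2 x) = beta2 (phi x).
  exact: esym (congr1 (@^~ x) b2_comm).
rewrite !gE; exact: (congr1 (@^~ x) b1_comm).
Qed.
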